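(* Let $G$ be a finite graph with at least one vertex such that (i) for every two distinct nonadjacent vertices $u,v$ of $G$, there are exactly two vertices adjacent to both $u$ and $v$, and these two vertices are adjacent to each other; and (ii) $G$ has no clique of cardinality four. Then $G$ has a universal vertex, i.e. a vertex adjacent to every other vertex of $G$.
   Context: Graphs are finite and simple. (The paper calls a graph satisfying (i) and (ii) ''bijoined''.) *)

(* Defs.v *)
From mathcomp Require Import all_boot.

Set Implicit Arguments.
Unset Strict Implicit.
Unset Printing Implicit Defensive.

(* A finite simple graph is a symmetric irreflexive relation [e] on a finite
   type [T] of vertices; both properties are hypotheses of the theorem. *)

Definition common_nbrs (T : finType) (e : rel T) (u v : T) : {set T} :=
  [set w | e u w && e v w].

Definition is_clique (T : finType) (e : rel T) (Q : {set T}) : Prop :=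
  forall x y : T, x \in Q -> y \in Q -> x != y -> e x y.

Definition universal_vertex (T : finType) (e : rel T) (c : T) : Prop :=
  forall x : T, x != c -> e c x.

(* Main.v *)
(** Suppose there is no universal vertex.  In the neighbourhood of a vertex [v]
there is no triangle, and two nonadjacent vertices have exactly one common
neighbour; moreover no vertex [c] dominates it, since every vertex not adjacent
to [v] shares with [v] an edge of this neighbourhood, which would contain [c],
so that [c] would be universal.  As in the friendship theorem, this forces the
neighbourhood to be regular.  Hence all edges have the same codegree [d >= 2],
and the graph is strongly regular of degree [d ^ 2 + 1], with [lambda = d] and
[mu = 2].  Comparing the trace of the adjacency matrix with the multiplicities
of its two nontrivial eigenvalues shows that [d (5 d - 4)] is a square and that
[5 d - 4] divides a fixed number; only [d = 4] survives, and there the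
multiplicities would be half-integers. *)

From Stdlib Require Import ZArith.
Require Import Defs.
From mathcomp Require Import all_boot.
From mathcomp Require Import all_order all_algebra all_field zify ring.

Set Implicit Arguments.
Unset Strict Implicit.
Unset Printing Implicit Defensive.

Import GRing.Theory Num.Theory.

Local Open Scope ring_scope.

(** * Traces and eigenvalue multiplicities of strongly regular graphs *)

(** In the full-rank factorisation [P = col_base P *m row_base P], idempotence lets the outer
    factors be cancelled, leaving [row_base P *m col_base P = 1%:M]. *)
Lemma mxtrace_idempotent (F : fieldType) n (P : 'M[F]_n) :
  P *m P = P -> \tr P = (\rank P)%:R.
Proof.
move=> PP; rewrite -{1}[P]mulmx_base mxtrace_mulC.
suff -> : row_base P *m col_base P = 1%:M by rewrite mxtrace1.
apply: (row_full_inj (col_base_full P)).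
apply: (row_free_inj (row_base_free P)).
rewrite /= mulmx1 -[LHS]mulmxA -[in LHS]mulmxA mulmx_base mulmxA !mulmx_base.
exact: PP.
Qed.

Lemma mulmx_ones (R : pzSemiRingType) n :
  (const_mx 1 : 'M[R]_n) *m const_mx 1 = const_mx n%:R :> 'M_n.
Proof.
apply/matrixP=> i j; rewrite !mxE (eq_bigr (fun=> 1)) => [|l _].
  by rewrite sumr_const card_ord.
by rewrite !mxE mulr1.
Qed.

(* [M] has eigenvalues [sqrtC D] and [- sqrtC D] only; [r] is the multiplicity
   of the former. *)
Lemma trace_sqrt_scalar (C : numClosedFieldType) n (M : 'M[C]_n) (D : C) :
  D != 0 -> M *m M = D%:M ->
  exists r : nat, \tr M = sqrtC D * (r.*2%:R - n%:R).
Proof.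
set s := sqrtC D => D0 MM.
have ss : s * s = D by rewrite -expr2 sqrtCK.
have s0 : s != 0 by apply: contraNneq D0 => s0; rewrite -ss s0 mul0r.
(* [P] projects onto the eigenspace of [s]; its rank is the required [r]. *)
pose P := (2 * s)^-1 *: (M + s%:M).
have PP : P *m P = P.
  rewrite /P -scalemxAl -scalemxAr mulmxDl !mulmxDr MM mul_scalar_mx.
  rewrite mul_mx_scalar -scalar_mxM ss.
  apply/matrixP=> i j; rewrite !mxE -ss mulr_natl.
  by case: (i == j); rewrite ?mulr1n ?mulr0n; field; rewrite s0.
exists (\rank P); have := mxtrace_idempotent PP.
rewrite linearZ /= mxtraceD mxtrace_scalar => /(congr1 ( *%R (2 * s))).
rewrite mulVKf ?mulf_neq0 ?pnatr_eq0 // => /(canRL (addrK _)) ->.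
by rewrite -muln2 natrM -mulr_natr; ring.
Qed.

(** Completing the square, [2 *: A - (l - u)%:M] squares to [D%:M] plus a multiple of the all-one
    matrix. A correction removes that multiple, and the trace of the result counts
    multiplicities. *)
Lemma srg_trace (C : numClosedFieldType) n (A : 'M[C]_n) (k l u D : C) :
    D = (l - u) ^+ 2 + 4 * (k - u) -> D != 0 -> (0 < n)%N ->
    A *m A = (k - u)%:M + (l - u) *: A + const_mx u ->
    A *m const_mx 1 = k *: const_mx 1 :> 'M_n ->
    const_mx 1 *m A = k *: const_mx 1 :> 'M_n -> \tr A = 0 ->
  exists r : nat,
    (2 * k + n.-1%:R * (l - u)) ^+ 2 = D * (n.-1%:R - r.*2%:R) ^+ 2.
Proof.
set J := const_mx 1 => defD D0 n_gt0 AA AJ JA trA.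
have JJ : J *m J = n%:R *: J.
  by rewrite mulmx_ones; apply/matrixP=> i j; rewrite !mxE mulr1.
have n0 : n%:R != 0 :> C by rewrite pnatr_eq0 -lt0n.
(* Both sides of the relation for [A *m A] are applied to [J]. *)
have kk : k * k = (k - u) + (l - u) * k + u * n%:R.
  have: A *m A *m J = (k * k) *: J.
    by rewrite -mulmxA AJ -scalemxAr AJ scalerA.
  have -> : A *m A = (k - u)%:M + (l - u) *: A + u *: J.
    by rewrite AA; congr (_ + _); apply/matrixP=> i j; rewrite !mxE mulr1.
  rewrite !mulmxDl -!scalemxAl AJ JJ mul_scalar_mx => /matrixP.
  move=> /(_ (Ordinal n_gt0) (Ordinal n_gt0)); rewrite !mxE !mulr1 => <-.
  by ring.
pose b := 2 * k - (l - u).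
have [c cn] : exists c, n%:R * c = b + sqrtC D.
  by exists ((b + sqrtC D) / n%:R); rewrite mulrC divfK.
(* This makes the coefficient of [J] in [M *m M] vanish. *)
have cc : c * (c * n%:R) = 2 * b * c - 4 * u.
  have sb : (sqrtC D - b) * (b + sqrtC D) = - (4 * u) * n%:R.
    have un : u * n%:R = k * k - (k - u) - (l - u) * k by rewrite kk; ring.
    rewrite mulNr -mulrA un /b.
    transitivity (sqrtC D ^+ 2 - (2 * k - (l - u)) ^+ 2); first by ring.
    by rewrite sqrtCK defD; ring.
  have cu : (sqrtC D - b) * c = - (4 * u).
    by apply: (mulIf n0); rewrite -sb -cn -mulrA (mulrC c).
  by rewrite (mulrC c n%:R) cn -[4 * u]opprK -cu; ring.
(* [c] is chosen so that the correction by [c *: J] moves the eigenvalue of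
   [2 *: A - (l - u)%:M] on the all-one vector to [- sqrtC D]. *)
pose M := 2 *: A - (l - u)%:M - c *: J.
have MM : M *m M = D%:M.
  rewrite /M !(mulmxBl, mulmxBr) -!(scalemxAl, scalemxAr) AA AJ JA JJ.
  rewrite !(mul_scalar_mx, mul_mx_scalar).
  apply/matrixP=> i j; rewrite !mxE !mulr1 cc defD /b.
  by case: (i == j); rewrite ?mulr1n ?mulr0n; ring.
have [r trM] := trace_sqrt_scalar D0 MM; exists r.
have trJ : \tr J = n%:R.
  rewrite /mxtrace (eq_bigr (fun=> 1)) => [|i _]; last by rewrite mxE.
  by rewrite sumr_const card_ord.
have ->: 2 * k + n.-1%:R * (l - u) = sqrtC D * (n.-1%:R - r.*2%:R).
  have Sn : n%:R = n.-1%:R + 1 :> C by rewrite natr1 prednK.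
  move: trM; rewrite !linearB /= !linearZ /= trA mxtrace_scalar trJ.
  rewrite -[_ *+ n]mulr_natr (mulrC c) cn Sn /b => E.
  transitivity (- (sqrtC D * (r.*2%:R - (n.-1%:R + 1))) - sqrtC D);
    last by ring.
  by rewrite -E; ring.
by rewrite exprMn sqrtCK.
Qed.

Local Close Scope ring_scope.

(** [m] is the absolute difference of the multiplicities of the two nontrivial eigenvalues; they sum
    to [#|T|.-1], whence the parity. The bounds on [u] make the subtractions exact. *)
Lemma strongly_regular_multiplicities (T : finType) (e : rel T) (k l u : nat) :
    symmetric e -> irreflexive e -> 0 < #|T| -> u <= k -> u <= l ->
    0 < (l - u) ^ 2 + 4 * (k - u) ->
    (forall x, #|[set y | e x y]| = k) ->
    (forall x y, e x y -> #|common_nbrs e x y| = l) ->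
    (forall x y, x != y -> ~~ e x y -> #|common_nbrs e x y| = u) ->
  exists2 m : nat, odd m = odd #|T|.-1 &
    (2 * k + #|T|.-1 * (l - u)) ^ 2 = ((l - u) ^ 2 + 4 * (k - u)) * m ^ 2.
Proof.
move=> e_sym e_irr T0 uk ul D0 deg_k edge_l nonedge_u.
set D := (l - u) ^ 2 + 4 * (k - u) in D0 *.
pose v (i : 'I_#|T|) : T := enum_val i.
pose A : 'M[algC]_#|T| := (\matrix_(i, j) (e (v i) (v j))%:R)%R.
have sum_v (F : T -> algC) : (\sum_i F (v i) = \sum_x F x)%R.
  by rewrite [RHS](reindex _ (onW_bij _ (@enum_val_bij T))).
have sum_pred (p : pred T) : (\sum_x (p x)%:R = #|p|%:R :> algC)%R.
  by rewrite -natr_sum -sum1_card [in RHS]big_mkcond.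
have AA : (A *m A = (k%:R - u%:R)%:M + (l%:R - u%:R) *: A + const_mx u%:R)%R.
  apply/matrixP=> i j; rewrite !mxE.
  under eq_bigr do rewrite !mxE -natrM mulnb.
  rewrite (sum_v (fun x => (e (v i) x && e x (v j))%:R%R)).
  rewrite (sum_pred (fun x => e (v i) x && e x (v j))).
  have -> : #|(fun x => e (v i) x && e x (v j))| = #|common_nbrs e (v i) (v j)|.
    by apply: eq_card => x; rewrite !inE unfold_in (e_sym x).
  have [<-|ij] := eqVneq i j.
    rewrite e_irr mulr0 addr0 subrK; congr (_%:R)%R.
    by rewrite -(deg_k (v i)); apply: eq_card => x; rewrite !inE andbb.
  rewrite mulr0n add0r; have [vij|nvij] := boolP (e (v i) (v j)).
    by rewrite edge_l // mulr1 subrK.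
  by rewrite nonedge_u ?mulr0 ?add0r // (inj_eq enum_val_inj).
have row_k i : (\sum_j A i j = k%:R)%R.
  under eq_bigr do rewrite mxE.
  rewrite (sum_v (fun x => (e (v i) x)%:R%R)) sum_pred -(deg_k (v i)).
  by congr (_%:R)%R; apply: eq_card => x; rewrite inE.
have AJ : (A *m const_mx 1 = k%:R *: const_mx 1 :> 'M_#|T|)%R.
  apply/matrixP=> i j; rewrite !mxE mulr1 -(row_k i).
  by apply: eq_bigr => h _; rewrite [const_mx _ _ _]mxE mulr1.
have JA : (const_mx 1 *m A = k%:R *: const_mx 1 :> 'M_#|T|)%R.
  apply/matrixP=> i j; rewrite !mxE mulr1 -(row_k j).
  by apply: eq_bigr => h _; rewrite !mxE mul1r e_sym.
have trA : (\tr A = 0)%R by apply: big1 => i _; rewrite mxE e_irr.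
have defD : (D%:R = (l%:R - u%:R) ^+ 2 + 4 * (k%:R - u%:R) :> algC)%R.
  by rewrite -!natrB // -natrX -natrM -natrD.
have [|r] := srg_trace defD _ T0 AA AJ JA trA; first by rewrite pnatr_eq0 -lt0n.
have : exists2 m : nat, odd m = odd #|T|.-1 &
    ((#|T|.-1%:R - r.*2%:R) ^+ 2 = (m ^ 2)%:R :> algC)%R.
  have [le|/ltnW le] := leqP r.*2 #|T|.-1.
    by exists (#|T|.-1 - r.*2); rewrite ?oddB ?odd_double ?addbF // natrX natrB.
  exists (r.*2 - #|T|.-1); first by rewrite oddB ?odd_double.
  by rewrite natrX natrB // -sqrrN opprB.
case=> m odd_m -> Em; exists m => //; apply/eqP; rewrite -(eqr_nat algC).
by rewrite natrX natrD !natrM natrB // Em -natrM.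
Qed.

(** * Arithmetic excluding integral multiplicities *)

(* [9184 = 4 * 41 * 56] is the residue of [5 ^ 5 * p] modulo [5 * d - 4] in
   [square_condition] below; binary numbers make the search computable. *)
Definition admissible_divisor (q : N) : bool :=
  [&& N.eqb (N.modulo (9184 * 9184) q) 0, N.eqb (N.modulo q 5) 1 &
   let x := N.mul q (N.div (q + 4) 5) in
   N.eqb (N.mul (N.sqrt x) (N.sqrt x)) x].

(* One of two complementary divisors of [9184 ^ 2] is at most [9184]. *)
Lemma admissible_divisors_checked : all (fun i => let c := N.of_nat i in
   (admissible_divisor c ==> (N.eqb c 1 || N.eqb c 16)) &&
   (let q := N.div (9184 * 9184) c in
    (admissible_divisor q ==> (N.eqb q 1 || N.eqb q 16))))
  (iota 1 (4 * 41 * 56)).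
Proof. by vm_compute. Qed.

(** [q] passes the tests of [admissible_divisor], and either [q] or its cofactor lies in the checked
    range. Of the two survivors, [q = 1] means [d = 1] and [q = 16] means [d = 4]. *)
Lemma divisor_square_product (d q s : nat) :
  q + 4 = 5 * d -> q * d = s * s -> 1 < d -> q %| (4 * 41 * 56) ^ 2 -> d = 4.
Proof.
move=> q4 qd d1; rewrite -mulnn; set B := 4 * 41 * 56 => /dvdnP[c qc].
have B2 : (9184 * 9184)%num = N.of_nat (B * B).
  by rewrite !Nnat.Nat2N.inj_mul.
have q0 : 0 < q by lia.
have adm : admissible_divisor (N.of_nat q).
  apply/and3P; split; apply/N.eqb_spec.
  - rewrite B2 qc; apply/N.Lcm0.mod_divide; exists (N.of_nat c).
    by rewrite Nnat.Nat2N.inj_mul.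
  - by symmetry; apply: (N.mod_unique _ _ (N.of_nat d.-1)); lia.
  have -> : (((N.of_nat q + 4) / 5) = N.of_nat d)%num.
    by symmetry; apply: (N.div_unique _ _ _ 0%num); clear qc; lia.
  have -> : (N.of_nat q * N.of_nat d = N.of_nat s * N.of_nat s)%num.
    by clear qc; lia.
  by rewrite N.sqrt_square.
have chk i : 0 < i <= B -> N.of_nat q = N.of_nat i \/
    N.of_nat q = N.div (9184 * 9184) (N.of_nat i) -> d = 4.
  move=> i_range; have /allP/(_ i) := admissible_divisors_checked.
  rewrite mem_iota add1n ltnS => /(_ i_range) /andP[/implyP h1 /implyP h2].
  clear qc B2 i_range.
  by case=> E; [move: h1 | move: h2]; rewrite -E => /(_ adm); clear -q4 d1; lia.
have [le|lt] := leqP q B; first by apply: (chk q); [rewrite q0 | left].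
have c_range : 0 < c <= B.
  rewrite lt0n leqNgt; apply/andP; split.
    by apply/eqP=> c0; move/eqP: qc; rewrite c0 muln_eq0.
  by apply/negP=> lt'; have := ltn_mul lt' lt; rewrite qc ltnn.
apply: (chk c c_range); right; apply: N.div_unique_exact.
  by case/andP: c_range => c0 _; clear -c0; lia.
by rewrite B2 qc Nnat.Nat2N.inj_mul.
Qed.

(** [q = 5 * d - 4] divides [p ^ 2]; as [p] has degree 5 in [d] and [5 * d] is 4 modulo [q],
    [5 ^ 5 * p] is constant modulo [q]. *)
Lemma square_condition (d s p : nat) : 1 < d ->
  p = d * (d ^ 2 + 1) * (d ^ 2 + 4 - 3 * d) ->
  s ^ 2 = d * (5 * d - 4) -> s ^ 2 %| p ^ 2 -> d = 4.
Proof.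
move=> d1 defp defs sp; have [q q4] : exists q, q + 4 = 5 * d.
  by exists (5 * d - 4); lia.
have {}defs : s ^ 2 = d * q by rewrite defs; congr (_ * _); lia.
apply: (@divisor_square_product d q s) => //.
  by rewrite mulnC -defs mulnn.
have qp : q %| (3125 * p) ^ 2.
  by rewrite expnMn dvdn_mull // (dvdn_trans _ sp) // defs dvdn_mull.
(* Multiplied by [5 ^ 5], the factors of [p] are [q + 4], [q ^ 2 + 8 * q + 41]
   and [q ^ 2 - 7 * q + 56]. *)
pose t1 := 7 * (q ^ 3 + 12 * q ^ 2 + 73 * q + 164).
pose t2 := q ^ 4 + 12 * q ^ 3 + 129 * q ^ 2 + 836 * q + 4088.
(* [q * t1] is the negative part of the expanded product, moved across to stay in [nat]. *)
have Et : 3125 * p + q * t1 = 4 * 41 * 56 + q * t2.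
  rewrite defp /t1 /t2; clear - d1 q4.
  have [x dx] : exists x, d = x + 2 by exists (d - 2); lia.
  subst d.
  have -> : q = 5 * x + 6 by lia.
  have -> : (x + 2) ^ 2 + 4 - 3 * (x + 2) = x ^ 2 + x + 2 by lia.
  lia.
have {}Et : 3125 * p = 4 * 41 * 56 %[mod q].
  by rewrite -(modnMDl t1) mulnC addnC Et addnC mulnC modnMDl.
by rewrite /dvdn -modnXm -Et modnXm.
Qed.

Lemma no_integral_multiplicities (d N m : nat) :
    1 < d -> 2 * N = (d ^ 2 + 1) * (d ^ 2 + 2 - d) ->
    (2 * (d ^ 2 + 1) + N * (d - 2)) ^ 2 = d * (5 * d - 4) * m ^ 2 ->
  odd m != odd N.
Proof.
move=> d1 defN Em.
set K := 2 * (d ^ 2 + 1) + N * (d - 2) in Em.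
have mK : m %| K by rewrite -(@dvdn_pexp2r _ _ 2) // Em dvdn_mull.
have K0 : 0 < K by rewrite /K; lia.
case/dvdnP: mK => s Ks.
have m0 : 0 < m by case: (m) Ks K0 => // ->; rewrite muln0.
have ss : s ^ 2 = d * (5 * d - 4).
  apply/eqP; rewrite -(eqn_pmul2r (_ : 0 < m ^ 2)) ?expn_gt0 ?m0 //.
  by rewrite -expnMn -Ks Em.
have d4 : d = 4.
  apply: (square_condition d1 erefl ss).
  (* [s] divides [K], and [2 * K] is the polynomial [p] of [square_condition]. *)
  have <- : 2 * K = d * (d ^ 2 + 1) * (d ^ 2 + 4 - 3 * d).
    rewrite /K mulnDr (mulnA 2 N) defN.
    case: d d1 {defN Em ss K Ks K0} => [|[|x]] // _.
    have -> : x.+2 ^ 2 + 4 - 3 * x.+2 = x ^ 2 + x + 2 by lia.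
    have -> : x.+2 ^ 2 + 2 - x.+2 = x ^ 2 + 3 * x + 4 by lia.
    by rewrite subn2 /= -addn2; ring.
  by rewrite Ks !expnMn dvdn_mull // dvdn_mulr.
subst d; have N119 : N = 119 by lia.
rewrite N119 /K in Ks *; apply/negP => /eqP om.
have s8 : s = 8 by nia.
by have m34 : m = 34 by [lia]; rewrite m34 in om.
Qed.

(** * Neighbourhoods and codegrees without a universal vertex *)

Lemma double_counting (T : finType) (A B : {set T}) (r : rel T) :
  \sum_(z in A) #|[set y in B | r z y]| = \sum_(y in B) #|[set z in A | r z y]|.
Proof.
have cardE (D : {set T}) (p : pred T) :
    #|[set y in D | p y]| = \sum_(y in D) p y.
  by rewrite -sum1_card big_mkcond [RHS]big_mkcond; apply: eq_bigr => y _;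
     rewrite inE; case: (y \in D); case: (p y).
under eq_bigr do rewrite cardE; rewrite exchange_big.
by under [RHS]eq_bigr do rewrite cardE.
Qed.

Section NoUniversalVertex.

Variables (T : finType) (e : rel T).
Hypotheses (e_sym : symmetric e) (e_irr : irreflexive e).
Hypothesis nonadj_common : forall u v : T, u != v -> ~~ e u v ->
  #|common_nbrs e u v| = 2 /\ is_clique e (common_nbrs e u v).
Hypothesis no_K4 : ~ exists Q : {set T}, is_clique e Q /\ #|Q| = 4.
Hypothesis no_universal : ~ exists c : T, universal_vertex e c.

Local Notation N v := [set w | e v w].
Local Notation codeg u v := #|common_nbrs e u v|.

Lemma adj_neq u v : e u v -> u != v.
Proof. by apply: contraTneq => ->; rewrite e_irr. Qed.

Lemma no_four_adjacent a b c d :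
  e a b -> e a c -> e b c -> e a d -> e b d -> e c d -> False.
Proof.
move=> ab ac bc ad bd cd; apply: no_K4; exists [set x in [:: a; b; c; d]].
split; last first.
  by rewrite cardsE (card_uniqP _) //= !inE !negb_or !adj_neq.
move=> x y; rewrite !inE => /or4P[]/eqP-> /or4P[]/eqP->;
  by rewrite ?eqxx // => _; rewrite // e_sym.
Qed.

Lemma not_universal c : exists2 x, x != c & ~~ e c x.
Proof.
case: (pickP [pred x | (x != c) && ~~ e c x]) => [x /andP[]|none].
  by exists x.
case: no_universal; exists c => x xc.
by have := none x; rewrite /= xc => /negbFE.
Qed.

(** Seen from [w]: inside its neighbourhood, the nonadjacent [u] and [v] have [z] as only common
    neighbour. *)
Lemma common_nbrs_pair u v w : u != v -> ~~ e u v -> e u w -> e v w ->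
  exists z, [/\ e u z, e v z, e w z & common_nbrs e u v = [set w; z]].
Proof.
move=> uv nuv uw vw; have [/eqP c2 clq] := nonadj_common uv nuv.
have [a [b [ab CNab]]] := cards2P _ c2.
have: a \in common_nbrs e u v by rewrite CNab !inE eqxx.
have: b \in common_nbrs e u v by rewrite CNab !inE eqxx orbT.
have: w \in common_nbrs e u v by rewrite inE uw.
rewrite {1}CNab => w_ab bC aC; have eab := clq _ _ aC bC ab.
move: bC aC; rewrite !inE => /andP[ub vb] /andP[ua va].
move: w_ab; rewrite !inE => /orP[] /eqP->.
  by exists b; split.
by exists a; split; rewrite // 1?e_sym // CNab setUC.
Qed.

Lemma not_dominated v c : e v c -> exists x, [/\ e v x, x != c & ~~ e c x].
Proof.
move=> vc; case: (pickP [pred x | [&& e v x, x != c & ~~ e c x]]).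
  by move=> x /and3P[]; exists x.
move=> dom; case: no_universal; exists c => w wc.
have domc x : e v x -> x != c -> e c x.
  by move=> vx xc; have := dom x; rewrite /= vx xc => /negbFE.
have [<-|vw] := eqVneq v w; first by rewrite e_sym.
have [|nvw] := boolP (e v w); first by move/domc; apply.
have [/eqP c2 clq] := nonadj_common vw nvw.
have [a [b [ab CNab]]] := cards2P _ c2.
have aC: a \in common_nbrs e v w by rewrite CNab !inE eqxx.
have bC: b \in common_nbrs e v w by rewrite CNab !inE eqxx orbT.
have eab := clq _ _ aC bC ab.
move: bC aC; rewrite !inE => /andP[vb wb] /andP[va wa].
have [<-|ac] := eqVneq a c; first by rewrite e_sym.
have [<-|bc] := eqVneq b c; first by rewrite e_sym.
(* If [c] is neither [a] nor [b], then [v], [c], [a], [b] form a clique. *)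
by case: (no_four_adjacent vc va (domc _ va ac) vb (domc _ vb bc) eab).
Qed.

Lemma codegC u v : codeg u v = codeg v u.
Proof. by congr #|pred_of_set _|; apply/setP=> w; rewrite !inE andbC. Qed.

(** The map [f] injects the common neighbours of [v] and [x] into those of [v] and [y]: if [p] and
    [p'] have the same image [q], both are the unique common neighbour of [x] and [q] inside the
    neighbourhood of [v]. *)
Lemma leq_codeg v x y : e v x -> e v y -> x != y -> ~~ e x y ->
  codeg v x <= codeg v y.
Proof.
move=> vx vy xy nxy.
have [||z [xz yz vz CNxy]] := common_nbrs_pair xy nxy (w := v); rewrite 1?e_sym //.
have eqz w : e v w -> e x w -> e y w -> w = z.
  move=> vw xw yw; have: w \in common_nbrs e x y by rewrite inE xw.
  by rewrite CNxy !inE eq_sym (negPf (adj_neq vw)) => /eqP.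
(* [f p] is the only common neighbour of [p] and [y] inside the neighbourhood of
   [v]. *)
pose f p := if p == z then z else
  if [pick q | [&& e v q, e p q & e y q]] is Some q then q else p.
(* The search in [f] succeeds here, so its default value [p] is not taken. *)
have fP p : e v p -> e x p -> p != z -> [/\ e v (f p), e p (f p) & e y (f p)].
  move=> vp xp pz; rewrite /f (negPf pz); case: pickP => [q /and3P[]//|none].
  have npy : ~~ e p y.
    apply: contraNN pz => py.
    by apply/eqP/eqz; rewrite 1?e_sym // e_sym.
  have py : p != y by apply: contraNneq nxy => <-.
  have [||q [pq yq vq _]] := common_nbrs_pair py npy (w := v); rewrite 1?e_sym //.
  by have := none q; rewrite /= vq pq yq.
have fz : f z = z by rewrite /f eqxx.
(* Otherwise [x], [p], [z] is a triangle in the neighbourhood of [v]. *)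
have not_z p : e v p -> e x p -> e p z -> False.
  by move=> vp xp pz; apply: (no_four_adjacent vx vp xp vz xz pz).
have injf : {in common_nbrs e v x &, injective f}.
  move=> p p'; rewrite !inE => /andP[vp xp] /andP[vp' xp'].
  have [->|pz] := eqVneq p z; have [->|p'z] := eqVneq p' z => //.
  - by rewrite fz => E; have [_ + _] := fP _ vp' xp' p'z; rewrite -E => /not_z[].
  - by rewrite fz => E; have [_ + _] := fP _ vp xp pz; rewrite E => /not_z[].
  have [] := fP _ vp xp pz; have [] := fP _ vp' xp' p'z.
  move: (f p) (f p') => q q' + + + + + + E; rewrite -{q'}E => vq p'q yq _ pq _.
  have xq : x != q by apply: contraNneq nxy => ->; rewrite e_sym.
  have nxq : ~~ e x q.
    by apply/negP=> exq; apply: (not_z p) => //; rewrite -(eqz q).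
  have [||r [_ _ _ CNxq]] := common_nbrs_pair xq nxq (w := v); rewrite 1?e_sym //.
  have is_r s : e v s -> e x s -> e s q -> s = r.
    move=> vs xs sq; have: s \in common_nbrs e x q by rewrite inE xs e_sym.
    by rewrite CNxq !inE eq_sym (negPf (adj_neq vs)) => /eqP.
  by rewrite (is_r p) // (is_r p').
rewrite -(card_in_imset injf); apply/subset_leq_card/subsetP=> _ /imsetP[p + ->].
rewrite !inE => /andP[vp xp]; have [->|pz] := eqVneq p z; first by rewrite fz vz.
by have [-> _ ->] := fP _ vp xp pz.
Qed.

Lemma codeg_nonadj v x y : e v x -> e v y -> ~~ e x y -> codeg v x = codeg v y.
Proof.
move=> vx vy nxy; have [->//|xy] := eqVneq x y.
by apply/eqP; rewrite eqn_leq !leq_codeg // 1?eq_sym // e_sym.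
Qed.

(** Codegrees agree along nonadjacent pairs. If no such path through [x'] and [y'] links [x] to [y],
    then [y] and [y'] are two common neighbours of the nonadjacent [x] and [x'] inside the
    neighbourhood of [v]. *)
Lemma codeg_at v x y : e v x -> e v y -> codeg v x = codeg v y.
Proof.
move=> vx vy; have [xy|] := boolP (e x y); last exact: codeg_nonadj.
have [x' [vx' x'x nxx']] := not_dominated vx.
have [y' [vy' y'y nyy']] := not_dominated vy.
have [yx'|nyx'] := boolP (e y x'); last first.
  by rewrite (codeg_nonadj vx vx' nxx') (codeg_nonadj vy vx' nyx').
have [xy'|nxy'] := boolP (e x y'); last first.
  by rewrite (codeg_nonadj vx vy' nxy') (codeg_nonadj vy vy' nyy').
have [x'y'|nx'y'] := boolP (e x' y'); last first.
  rewrite (codeg_nonadj vx vx' nxx') (codeg_nonadj vx' vy' nx'y').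
  by rewrite (codeg_nonadj vy vy' nyy').
rewrite eq_sym in x'x.
have [||r [_ _ _ CN]] := common_nbrs_pair x'x nxx' (w := v); rewrite 1?e_sym //.
have is_r s : e v s -> e x s -> e x' s -> s = r.
  move=> vs xs sq; have: s \in common_nbrs e x x' by rewrite inE xs.
  by rewrite CN !inE eq_sym (negPf (adj_neq vs)) => /eqP.
by case/eqP: y'y; rewrite (is_r y') // (is_r y) // e_sym.
Qed.

(** Edges sharing an endpoint have equal codegree, and any two vertices are at distance at most
    two. *)
Lemma codeg_const u v x y : e u v -> e x y -> codeg u v = codeg x y.
Proof.
move=> uv; have [<-|ux] := eqVneq u x; first exact: codeg_at.
move=> xy.
have via w : e u w -> e w x -> codeg u v = codeg x y.
  move=> uw wx; have wu : e w u by rewrite e_sym.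
  rewrite (codeg_at uv uw) codegC (codeg_at wu wx) codegC.
  by apply: codeg_at; first rewrite e_sym.
have [eux|nux] := boolP (e u x).
  by rewrite (codeg_at uv eux) codegC; apply: codeg_at; first rewrite e_sym.
have [/eqP c2 _] := nonadj_common ux nux; have [w [z [_ CN]]] := cards2P _ c2.
have: w \in common_nbrs e u x by rewrite CN !inE eqxx.
by rewrite inE (e_sym x) => /andP[]; apply: via.
Qed.

(** * Degree and order by double counting *)

(** Edges from the common neighbours of [v] and [x] into [N v] number [d ^ 2]. Counted from [y] in
    [N v], there are [d] for [y = x], none if [y] is adjacent to [x], and one otherwise. *)
Lemma degree_from_codegree d v : (forall x y, e x y -> codeg x y = d) ->
  #|N v| = d ^ 2 + 1.
Proof.
move=> edge_d.
have [x vx] : exists x, e v x.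
  have [w wv nvw] := not_universal v.
  rewrite eq_sym in wv; have [/eqP c2 _] := nonadj_common wv nvw.
  have [x [y [_ CN]]] := cards2P _ c2; exists x.
  have: x \in common_nbrs e v w by rewrite CN !inE eqxx.
  by rewrite inE => /andP[].
have := double_counting (common_nbrs e v x) (N v) e.
under eq_bigr => z.
  rewrite inE => /andP[vz _].
  have -> : [set y in N v | e z y] = common_nbrs e v z.
    by apply/setP=> y; rewrite !inE.
  rewrite [#|_|](edge_d _ _ vz); over.
rewrite sum_nat_const [#|common_nbrs _ _ _|](edge_d _ _ vx).
rewrite (bigD1 x) ?inE //= (bigID (e x)) /= => E.
have N_split : #|N v| = 1 + (d + #|[set y in N v | (y != x) && ~~ e x y]|).
  rewrite (cardsD1 x) inE vx; congr (_ + _).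
  rewrite -(cardsID [set y | e x y]) -(edge_d _ _ vx); congr (_ + _).
    apply: eq_card => y; rewrite !inE.
    by have [->|_] := eqVneq y x; rewrite ?e_irr ?andbF.
  apply: eq_card => y; rewrite !inE.
  by case: (y == x); case: (e x y); rewrite ?andbF ?andbT.
rewrite N_split; move: E.
have -> : [set z in common_nbrs e v x | e z x] = common_nbrs e v x.
  by apply/setP=> z; rewrite !inE (e_sym z) -andbA andbb.
rewrite [#|common_nbrs _ _ _|](edge_d _ _ vx) big1 => [|y]; last first.
  rewrite inE => /andP[/andP[vy yx] xy]; apply: eq_card0 => z; rewrite !inE.
  apply/negP=> /andP[/andP[vz xz] zy].
  by apply: (no_four_adjacent vx vy xy vz xz); rewrite e_sym.
rewrite (eq_bigr (fun=> 1)) => [|y]; last first.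
  rewrite inE => /andP[/andP[vy yx] nxy].
  rewrite eq_sym in yx.
  have [||r [_ _ vr CN]] := common_nbrs_pair yx nxy (w := v); rewrite 1?e_sym //.
  rewrite -(cards1 r); apply: eq_card => z.
  move/setP/(_ z): CN; rewrite !inE -andbA (e_sym z) => ->.
  have [->|zv] /= := eqVneq z v; last first.
    by have [->|_] := eqVneq z r; rewrite ?vr ?andbF.
  by rewrite e_irr; apply/esym; apply: contraTF vr => /eqP<-; rewrite e_irr.
rewrite sum1dep_card => E.
rewrite (_ : #|[set y in N v | _]| =
  #|[set y | (y \in N v) && (y != x) && ~~ e x y]|).
  by rewrite -mulnn E; lia.
by apply: eq_card => z; rewrite !inE andbA.
Qed.

(** Walks of length two from [v] are counted by their endpoint: [v] itself, a neighbour, or a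
    nonneighbour. *)
Lemma order_from_codegree d : (forall x y, e x y -> codeg x y = d) ->
  0 < #|T| -> 2 * #|T|.-1 = (d ^ 2 + 1) * (d ^ 2 + 2 - d).
Proof.
move=> edge_d T0; have /card_gt0P[v _] := T0.
have := double_counting (N v) setT e.
under eq_bigr => z _.
  have -> : [set y in setT | e z y] = N z by apply/setP=> y; rewrite !inE.
  rewrite (degree_from_codegree z edge_d); over.
rewrite sum_nat_const (degree_from_codegree v edge_d).
rewrite (bigD1 v) ?inE //= (bigID (e v)) /= => E.
have T_split : #|T| = 1 + (d ^ 2 + 1 + #|[set y | (y != v) && ~~ e v y]|).
  rewrite -cardsT (cardsD1 v) inE; congr (_ + _).
  rewrite -(cardsID (N v)) -(degree_from_codegree v edge_d); congr (_ + _).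
    apply: eq_card => y; rewrite !inE.
    by have [->|_] := eqVneq y v; rewrite ?e_irr ?andbF.
  by apply: eq_card => y; rewrite !inE andbT andbC.
move: E.
have -> : [set z in N v | e z v] = N v.
  by apply/setP=> z; rewrite !inE (e_sym z) andbb.
rewrite (degree_from_codegree v edge_d) (eq_bigr (fun=> d)) => [|y]; last first.
  rewrite inE => /andP[/andP[_ yv] vy]; rewrite -(edge_d _ _ vy).
  by apply: eq_card => z; rewrite !inE (e_sym z).
rewrite sum_nat_cond_const [X in _ + (X + _)](_ : _ = (d ^ 2 + 1) * d); last first.
  congr (_ * _); rewrite -(degree_from_codegree v edge_d).
  apply: eq_card => y; rewrite !inE.
  by have [->|_] := eqVneq y v; rewrite ?e_irr.
rewrite (eq_bigr (fun=> 2)) => [|y]; last first.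
  rewrite inE /= => /andP[yv nvy]; rewrite eq_sym in yv.
  have [<- _] := nonadj_common yv nvy.
  by apply: eq_card => z; rewrite !inE (e_sym z).
rewrite sum_nat_cond_const => E.
have /eq_card ER : [set x | (x \in setT) && (x != v) & ~~ e v x] =i
    [set y | y != v & ~~ e v y] by move=> y; rewrite !inE.
rewrite T_split -{}ER add1n /=; move: E.
move: #|_| => r.
have le_d : d <= d ^ 2 + 2 by case: (d) => // d'; rewrite expnS; nia.
by move: le_d; move: (d ^ 2) => dd le_d; nia.
Qed.

Lemma codegree_gt1 d : (forall x y, e x y -> codeg x y = d) ->
  0 < #|T| -> 1 < d.
Proof.
move=> edge_d /card_gt0P[v _].
have [w w_v nvw] := not_universal v; rewrite eq_sym in w_v.
have [/eqP c2 _] := nonadj_common w_v nvw; have [x [y [_ CNvw]]] := cards2P _ c2.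
have: x \in common_nbrs e v w by rewrite CNvw !inE eqxx.
rewrite inE => /andP[vx _]; have [x' [vx' x'x nxx']] := not_dominated vx.
rewrite eq_sym in x'x.
have [||z [xz x'z vz _]] := common_nbrs_pair x'x nxx' (w := v); rewrite 1?e_sym //.
(* Three vertices in one neighbourhood force [d ^ 2 + 1 >= 3]. *)
have: uniq [:: x; x'; z] by rewrite /= !inE !negb_or x'x !adj_neq.
move/card_uniqP => c3; have: #|[:: x; x'; z]| <= #|N v|.
  by apply/subset_leq_card/subsetP=> t; rewrite !inE => /or3P[]/eqP->.
rewrite c3 (degree_from_codegree v edge_d) /=.
by case: d {edge_d} => [|[]].
Qed.

End NoUniversalVertex.

Theorem theorem2p4 (T : finType) (e : rel T)
  (e_sym : symmetric e) (e_irr : irreflexive e)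
  (T_nonempty : 0 < #|T|)
  (nonadj_common : forall u v : T, u != v -> ~~ e u v ->
     #|common_nbrs e u v| = 2 /\ is_clique e (common_nbrs e u v))
  (no_K4 : ~ exists Q : {set T}, is_clique e Q /\ #|Q| = 4) :
  exists c : T, universal_vertex e c.
Proof.
case: (pickP [pred c | [forall x, (x != c) ==> e c x]]) =>
  [c /= /forallP cP|none].
  by exists c => x; apply/implyP.
have no_universal : ~ exists c : T, universal_vertex e c.
  move=> [c cP]; have /forallP[] := negbT (none c).
  by move=> x; apply/implyP/cP.
have [d edge_d] : exists d, forall x y, e x y -> #|common_nbrs e x y| = d.
  have [/existsP[x /existsP[y xy]]|] := boolP [exists x, [exists y, e x y]].
    by exists #|common_nbrs e x y| => z t zt; apply: codeg_const.
  (* Without edges every [d] qualifies; [codegree_gt1] then refutes this case. *)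
  move=> /existsPn noedge; exists 0 => x y xy.
  by have /existsPn/(_ y) := noedge x; rewrite xy.
have d_gt1 : 1 < d by apply: (codegree_gt1 e_sym e_irr).
have deg x : #|[set y | e x y]| = d ^ 2 + 1 by apply: degree_from_codegree.
have order : 2 * #|T|.-1 = (d ^ 2 + 1) * (d ^ 2 + 2 - d).
  by apply: order_from_codegree.
have nonadj2 x y : x != y -> ~~ e x y -> #|common_nbrs e x y| = 2.
  by move=> xy nxy; have [] := nonadj_common _ _ xy nxy.
(* The discriminant for degree [d ^ 2 + 1], [lambda = d] and [mu = 2]. *)
have discr : (d - 2) ^ 2 + 4 * (d ^ 2 + 1 - 2) = d * (5 * d - 4).
  by case: d d_gt1 {edge_d deg order} => [|[|d]] // _; nia.
have le2k : 2 <= d ^ 2 + 1 by rewrite addn1 ltnS expn_gt0 ltnW.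
have discr_gt0 : 0 < (d - 2) ^ 2 + 4 * (d ^ 2 + 1 - 2).
  by rewrite discr muln_gt0 subn_gt0; clear -d_gt1; lia.
have [m odd_m] := strongly_regular_multiplicities e_sym e_irr T_nonempty le2k
  d_gt1 discr_gt0 deg edge_d nonadj2.
rewrite discr => /(no_integral_multiplicities d_gt1 order).
by rewrite odd_m eqxx.
Qed.
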